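(* Let $\sigma$ be a primitive substitution on a finite alphabet $\mathcal A=\{a_1,\dots,a_k\}$ with $k\ge2$, and let $w=w_0w_1w_2\ldots$ be a one-sided infinite fixed point of $\sigma$. The following are equivalent: (i) $w$ is not eventually periodic (i.e. $\sigma$ is aperiodic); (ii) there exists $1\le i\le k$ such that $C_{a_i}(X)$ is transcendental over $\mathbb{Q}(X)$; (iii) there exist $1\le i<j\le k$ such that $C_{a_i}(X)$ and $C_{a_j}(X)$ are both transcendental over $\mathbb{Q}(X)$; (iv) there exists $1\le i\le k$ such that $P_{a_i}(X)$ is transcendental over $\mathbb{Q}(X)$; (v) there exist $1\le i<j\le k$ such that $P_{a_i}(X)$ and $P_{a_j}(X)$ are both transcendental over $\mathbb{Q}(X)$.
   Context: A substitution on $\mathcal A$ is a map $\sigma$ from $\mathcal A$ to non-empty finite words over $\mathcal A$, extended to (finite and infinite) words by concatenation. Its matrix $A_\sigma$ has $(i,j)$ entry equal to the number of $a_j$ in $\sigma(a_i)$; $\sigma$ is primitive if some power of $A_\sigma$ has all entries positive. $w$ is a fixed point if $\sigma(w)=w$. A word $w$ is eventually periodic if there exist $N$, $d\ge1$ with $w_{n+d}=w_n$ for all $n\ge N$; $\sigma$ is called aperiodic if it has a one-sided infinite fixed word which is not eventually periodic. Positions are indexed from $0$. $C_{a_i}(X)=\sum_{n\ge0}1_{a_i}(w_n)X^n$, where $1_{a_i}$ is the indicator of $a_i$; for $n\ge1$, $p_i(n)$ is the position of the $n$-th occurrence of $a_i$ in $w$, and $P_{a_i}(X)=\sum_{n\ge1}p_i(n)X^n$.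 Transcendence over $\mathbb{Q}(X)$ is meant inside $\mathbb{C}((X))$. *)

(* Defs.v *)
From HB Require Import structures.
From mathcomp Require Import all_boot all_order all_algebra.
From Stdlib Require Import ClassicalEpsilon.
Set Implicit Arguments. Unset Strict Implicit. Unset Printing Implicit Defensive.
Import Order.TTheory GRing.Theory Num.Theory.
Local Open Scope ring_scope.

(* A substitution on the alphabet 'I_k (letters a_1..a_k = 0..k-1):
   sigma : 'I_k -> seq 'I_k, required to have non-empty images. *)

Definition subst_matrix (k : nat) (sigma : 'I_k -> seq 'I_k) : 'M[int]_k :=
  \matrix_(i < k, j < k) (count_mem j (sigma i))%:Z.

Definition mxpow (k : nat) (A : 'M[int]_k) (n : nat) : 'M[int]_k :=
  iter n (mulmx A) 1%:M.

Definition primitive (k : nat) (sigma : 'I_k -> seq 'I_k) : Prop :=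
  exists n : nat, (0 < n)%N /\
    forall i j : 'I_k, 0 < mxpow (subst_matrix sigma) n i j.

Definition pref (T : Type) (w : nat -> T) (n : nat) : seq T := mkseq w n.

(* sigma(w) = w: for each n, sigma(w_0)...sigma(w_{n-1}) is the prefix of w of
   the same length (this determines sigma(w) completely since images are
   non-empty). *)
Definition fixed_point (k : nat) (sigma : 'I_k -> seq 'I_k) (w : nat -> 'I_k) : Prop :=
  forall n : nat,
    let u := flatten (map sigma (pref w n)) in u = pref w (size u).

Definition eventually_periodic (T : Type) (w : nat -> T) : Prop :=
  exists N d : nat, (1 <= d)%N /\ forall n : nat, (N <= n)%N -> w (n + d)%N = w n.

Definition series := nat -> rat.

Definition smul (f g : series) : series :=
  fun n => \sum_(i < n.+1) f i * g (n - i)%N.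

Definition spow (f : series) (j : nat) : series :=
  iter j (smul f) (fun n => if n == 0%N then 1 else 0).

Definition poly_series (p : {poly rat}) : series := fun n => p`_n.

Definition eval_bipoly (P : {poly {poly rat}}) (f : series) : series :=
  fun n => \sum_(j < size P) smul (poly_series P`_j) (spow f j) n.

(* f algebraic over Q(X): root of a non-zero polynomial with coefficients in
   Q(X); after clearing denominators, coefficients in Q[X]. *)
Definition algebraic_QX (f : series) : Prop :=
  exists P : {poly {poly rat}}, P != 0 /\ forall n, eval_bipoly P f n = 0.

Definition transcendental_QX (f : series) : Prop := ~ algebraic_QX f.

Definition char_series (k : nat) (w : nat -> 'I_k) (a : 'I_k) : series :=
  fun n => if w n == a then 1 else 0.

(* p_a(n) for n >= 1: the position m of the n-th occurrence of a in w, i.e.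
   w_m = a and a occurs exactly n-1 times in w_0..w_{m-1}. *)
Definition occ_pos (k : nat) (w : nat -> 'I_k) (a : 'I_k) (n : nat) : nat :=
  epsilon (inhabits 0%N)
    (fun m => w m = a /\ count_mem a (pref w m) = n.-1).

Definition pos_series (k : nat) (w : nat -> 'I_k) (a : 'I_k) : series :=
  fun n => if n == 0%N then 0 else (occ_pos w a n)%:R.

(* Main.v *)
Require Import Defs.
From mathcomp Require Import all_boot all_order all_algebra all_field.
From mathcomp Require Import zify ring lra.
From Stdlib Require Import Classical ClassicalEpsilon.
Set Implicit Arguments. Unset Strict Implicit. Unset Printing Implicit Defensive.
Import Order.TTheory GRing.Theory Num.Theory.
Local Open Scope ring_scope.

(** Everything rests on a form of Fatou's theorem: an algebraic power series f
    with integer coefficients of at most linear growth is rational.  If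
    p_d f^d + ... + p_0 = 0 then p_d f is integral over Q[X], hence bounded on
    the unit disc, hence square-summable by Parseval; its coefficients having
    bounded denominators, it is a polynomial.  Working with truncations of f
    and averages over roots of unity makes this argument purely algebraic.

    If moreover f takes finitely many values, the resulting linear recurrence
    makes its coefficients eventually periodic.  By primitivity the gaps between
    occurrences of a letter a are bounded, so this applies to C_a and to
    (1 - X) P_a: each of C_a, P_a is algebraic iff the indicator sequence of a
    in w is eventually periodic.  The indicators sum to 1, so w is eventually
    periodic as soon as all of them but one are. *)

(** * Weighted l1 norms of polynomials *)
Definition wnorm (s : rat) (p : {poly rat}) : rat :=
  \sum_(i < size p) `|p`_i| * s ^+ i.

Lemma wnormE (s : rat) (p : {poly rat}) (K : nat) : (size p <= K)%N ->
  wnorm s p = \sum_(i < K) `|p`_i| * s ^+ i.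
Proof.
move=> le_pK; rewrite /wnorm (big_ord_widen K (fun i => `|p`_i| * s ^+ i)) //.
rewrite big_mkcond; apply: eq_bigr => i _; case: ltnP => // le_pi.
by rewrite nth_default // normr0 mul0r.
Qed.

Lemma wnorm_ge0 (s : rat) (p : {poly rat}) : 0 <= s -> 0 <= wnorm s p.
Proof. by move=> s0; apply: sumr_ge0 => i _; rewrite mulr_ge0 ?exprn_ge0. Qed.

Lemma wnorm0 (s : rat) : wnorm s 0 = 0.
Proof. by rewrite /wnorm size_poly0 big_ord0. Qed.

Lemma wnormD (s : rat) (p q : {poly rat}) : 0 <= s ->
  wnorm s (p + q) <= wnorm s p + wnorm s q.
Proof.
move=> s0; pose K := maxn (size p) (size q).
rewrite (wnormE _ (size_polyD p q)) (@wnormE s p K) ?leq_maxl //.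
rewrite (@wnormE s q K) ?leq_maxr // -big_split.
apply: ler_sum => i _; rewrite /= coefD -mulrDl.
by apply: ler_wpM2r; rewrite ?exprn_ge0 ?ler_normD.
Qed.

Lemma wnorm_sum (s : rat) (n : nat) (F : nat -> {poly rat}) : 0 <= s ->
  wnorm s (\sum_(i < n) F i) <= \sum_(i < n) wnorm s (F i).
Proof.
move=> s0; elim: n => [|n IHn]; first by rewrite !big_ord0 wnorm0.
rewrite !big_ord_recr /=; apply: le_trans (wnormD _ _ s0) _.
by rewrite lerD2r.
Qed.

Lemma wnormZ (s c : rat) (p : {poly rat}) : wnorm s (c *: p) = `|c| * wnorm s p.
Proof.
rewrite (wnormE _ (size_scale_leq c p)) mulr_sumr.
by apply: eq_bigr => i _; rewrite coefZ normrM mulrA.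
Qed.

Lemma wnorm_MXaddC (s c : rat) (p : {poly rat}) :
  wnorm s (p * 'X + c%:P) = wnorm s p * s + `|c|.
Proof.
rewrite (@wnormE s _ (size p).+1); last by rewrite size_MXaddC; case: ifP.
rewrite big_ord_recl coefD coefMX coefC /= add0r expr0 mulr1 addrC; congr (_ + _).
rewrite mulr_suml; apply: eq_bigr => i _.
by rewrite coefD coefMX coefC /= addr0 /bump /= add1n exprSr mulrA.
Qed.

(** Horner induction on [p]: multiplication by ['X] scales the norm by exactly [s], and the constant
    term costs one triangle inequality. *)
Lemma wnormM (s : rat) (p q : {poly rat}) : 0 <= s ->
  wnorm s (p * q) <= wnorm s p * wnorm s q.
Proof.
move=> s0; elim/poly_ind: p => [|p c IHp]; first by rewrite mul0r wnorm0 mul0r.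
rewrite mulrDl wnorm_MXaddC mulrDl -mulrA ['X * q]mulrC mulrA mul_polyC.
apply: le_trans (wnormD _ _ s0) _; rewrite wnormZ lerD2r.
have := wnorm_MXaddC s 0 (p * q); rewrite polyC0 addr0 normr0 addr0 => ->.
by rewrite mulrAC; apply: ler_wpM2r.
Qed.

Lemma wnormX (s : rat) (p : {poly rat}) (n : nat) : 0 <= s ->
  wnorm s (p ^+ n) <= wnorm s p ^+ n.
Proof.
move=> s0; elim: n => [|n IHn].
  by rewrite !expr0 /wnorm size_poly1 big_ord1 coef1 /= normr1 expr0 mulr1.
rewrite !exprS; apply: le_trans (wnormM _ _ s0) _.
by apply: ler_wpM2l => //; apply: wnorm_ge0.
Qed.

(** Transfers estimates made over [rat] to values at complex points of a disc. *)
Lemma norm_horner_le_wnorm (s : rat) (p : {poly rat}) (z : algC) :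
  0 <= s -> `|z| <= ratr s -> `|(map_poly ratr p).[z]| <= ratr (wnorm s p).
Proof.
move=> s0 zs; rewrite (horner_coef_wide _ (size_poly _ _)).
apply: le_trans (ler_norm_sum _ _ _) _.
rewrite rmorph_sum; apply: ler_sum => i _ /=.
rewrite coef_map normrM normrX rmorphM rmorphXn /= ratr_norm.
by apply: ler_wpM2l; rewrite ?normr_ge0 // lerXn2r ?nnegrE ?normr_ge0 // ler0q.
Qed.

(** Passing from radius [s] to [s ^+ 2] multiplies the i-th term by [s ^+ i], and only terms with i
    >= N survive. *)
Lemma wnorm_vanishing (s : rat) (N : nat) (p : {poly rat}) :
  0 <= s <= 1 -> (forall n, (n < N)%N -> p`_n = 0) ->
  wnorm (s ^+ 2) p <= s ^+ N * wnorm s p.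
Proof.
move=> /andP[s0 s1] p0; rewrite /wnorm mulr_sumr; apply: ler_sum => i _.
case: (ltnP i N) => [/p0->|le_Ni]; first by rewrite normr0 !mul0r mulr0.
rewrite mulrCA; apply: ler_wpM2l => //.
rewrite -exprM mul2n -addnn exprD; apply: ler_wpM2r; rewrite ?exprn_ge0 //.
by rewrite ler_wiXn2l.
Qed.

(* The substitution y = c_d x turns c_d^{d-1} (c_d x^d + ...) into a monic
   polynomial in y. *)
Lemma lead_root_bound (d : nat) (c : nat -> algC) (x A : algC) :
  1 <= A -> (forall j, (j <= d.+1)%N -> `|c j| <= A) ->
  `|\sum_(j < d.+2) c j * x ^+ j| <= 1 ->
  `|c d.+1 * x| <= d.+2%:R * A ^+ d.+1.
Proof.
move=> A1 cA S1; set y := c d.+1 * x.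
have A0 : 0 <= A by apply: le_trans A1.
have Y0 : 0 <= `|y| by [].
have AX n : 1 <= A ^+ n by rewrite exprn_ege1.
have [y1|/ltW y1] := real_leP (normr_real y) (@real1 _).
  by apply: le_trans y1 _; rewrite mulr_ege1 ?ler1n.
have key : y ^+ d.+1 = c d.+1 ^+ d * (\sum_(j < d.+2) c j * x ^+ j)
    - \sum_(j < d.+1) c j * c d.+1 ^+ (d - j) * y ^+ j.
  rewrite big_ord_recr /= mulrDr mulr_sumr addrAC -sumrB big1 ?add0r.
    by rewrite /y exprMn mulrA -exprSr.
  move=> j _; rewrite /y exprMn.
  have -> : c d.+1 ^+ d = c d.+1 ^+ (d - j) * c d.+1 ^+ j.
    by rewrite -exprD subnK // -ltnS.
  ring.
(* Since |y| >= 1, each of the d+1 lower terms is at most A^(d+1) |y|^d; the term carrying the small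
   sum adds one more. *)
have le1 : `|y| ^+ d.+1 <= d.+2%:R * A ^+ d.+1 * `|y| ^+ d.
  rewrite -normrX key; apply: le_trans (ler_normB _ _) _.
  rewrite -[d.+2]add1n natrD mulrDl mulrDl; apply: lerD.
    rewrite normrM mul1r -[X in X <= _]mulr1; apply: ler_pM => //.
    - by rewrite mulr_ge0.
    - rewrite -[A ^+ _]mulr1; apply: ler_pM => //.
      rewrite normrX; apply: le_trans (_ : A ^+ d <= _).
        by rewrite lerXn2r ?nnegrE // cA.
      by rewrite exprS ler_peMl // exprn_ge0.
    - by rewrite exprn_ege1.
  apply: le_trans (ler_norm_sum _ _ _) _.
  apply: le_trans (_ : \sum_(j < d.+1) A ^+ d.+1 * `|y| ^+ d <= _); last first.
    by rewrite sumr_const card_ord -[X in X <= _]mulr_natl mulrA.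
  apply: ler_sum => j _; have jd : (j <= d)%N by rewrite -ltnS.
  rewrite normrM normrX; apply: ler_pM; rewrite ?exprn_ge0 //.
  - rewrite exprS normrM; apply: ler_pM; rewrite ?cA ?normr_ge0 //; last 1 first.
      rewrite normrX; apply: le_trans (_ : A ^+ (d - j) <= _).
        by rewrite lerXn2r ?nnegrE // cA.
      by rewrite ler_weXn2l // leq_subr.
    by apply: leq_trans jd _.
  - by rewrite ler_weXn2l.
have yd : 0 < `|y| ^+ d by rewrite exprn_gt0 // (lt_le_trans _ y1).
by rewrite -(ler_pM2r yd) -exprS.
Qed.

(** * Averages over roots of unity *)

Lemma sum_unity_root (n : nat) (o : algC) : (0 < n)%N -> o ^+ n = 1 ->
  \sum_(k < n) o ^+ k = if o == 1 then n%:R else 0.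
Proof.
move=> n0 on; case: eqP => [->|/eqP o1].
  by under eq_bigr do rewrite expr1n; rewrite sumr_const card_ord.
have := subrX1 o n; rewrite on subrr => /esym/eqP.
by rewrite mulf_eq0 subr_eq0 (negbTE o1) => /eqP.
Qed.

(** Expand the squares and sum over [k] first: the conjugate of [z] is its inverse, so the (i, j)
    term is a geometric sum in z^i / z^j, which vanishes for distinct i, j < n. *)
Lemma discrete_parseval (n : nat) (z : algC) (a : nat -> algC) :
  n.-primitive_root z ->
  \sum_(k < n) `|\sum_(i < n) a i * z ^+ (k * i)| ^+ 2
    = n%:R * \sum_(i < n) `|a i| ^+ 2.
Proof.
move=> pz; have n0 := prim_order_gt0 pz; have zn := prim_expr_order pz.
have z1 : `|z| = 1.
  have /eqP := congr1 (@Num.norm _ algC) zn; rewrite normrX normr1.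
  by rewrite pexpr_eq1 // => /eqP.
have zz : z * z^* = 1 by rewrite -normCK z1 expr1n.
have zu : z != 0 by rewrite -normr_eq0 z1 oner_eq0.
have zc : z^* = z^-1 by apply: (mulfI zu); rewrite zz divff.
under eq_bigr => k _.
  rewrite normCK rmorph_sum mulr_suml /=.
  under eq_bigr => i _.
    rewrite mulr_sumr.
    under eq_bigr => j _ do
      rewrite rmorphM rmorphXn /= zc mulrACA [(k * i)%N]mulnC [(k * j)%N]mulnC
        !exprM -exprMn.
    over.
  over.
rewrite exchange_big /= mulr_sumr; apply: eq_bigr => i _.
rewrite exchange_big /= (bigD1 i) //= [X in _ + X]big1 ?addr0 => [|j ji].
  rewrite -mulr_sumr sum_unity_root //; last by rewrite -exprMn divff // !expr1n.
  by rewrite -exprMn divff // expr1n eqxx normCK mulrC.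
rewrite -mulr_sumr sum_unity_root //; last first.
  by rewrite exprMn -!exprM mulnC exprM zn mulnC exprM exprVn zn invr1 !expr1n mulr1.
case: eqP; last by rewrite mulr0.
rewrite exprVn => /divr1_eq /eqP; rewrite (eq_prim_root_expr pz) !modn_small //.
by move/eqP/val_inj => ij; rewrite ij eqxx in ji.
Qed.

(** * Algebraic series with integer coefficients *)

Lemma poly_sq_sum_le (g : {poly rat}) (r M : rat) (L : nat) :
  0 <= r -> 0 <= M ->
  (forall x : algC, `|x| = ratr r -> `|(map_poly ratr g).[x]| <= ratr M) ->
  \sum_(i < L) (g`_i * r ^+ i) ^+ 2 <= M ^+ 2.
Proof.
(* The sample of n points on the circle is fine enough to separate all coefficients of [g], and the
   resulting sum covers the first [L] of them. *)
move=> r0 M0 gM; pose n := (maxn (size g) L).+1.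
have [z pz] := C_prim_root_exists (ltn0Sn _ : (0 < n)%N).
have z1 : `|z| = 1.
  have /eqP := congr1 (@Num.norm _ algC) (prim_expr_order pz).
  by rewrite normrX normr1 pexpr_eq1 // => /eqP.
have gn : (size (map_poly ratr g : {poly algC}) <= n)%N.
  by rewrite size_map_poly (leq_trans (leq_maxl _ L)).
have := discrete_parseval (fun i => ratr (g`_i * r ^+ i)) pz.
set S := (X in X = _) => eqS.
have SM : S <= n%:R * ratr M ^+ 2.
  rewrite /S mulr_natl -[n in X in _ <= X]card_ord -sumr_const.
  apply: ler_sum => k _.
  have := gM (ratr r * z ^+ k); rewrite normrM normrX z1 expr1n mulr1.
  rewrite ger0_norm ?ler0q // => /(_ erefl).
  rewrite (horner_coef_wide _ gn) => le.
  rewrite lerXn2r ?nnegrE ?normr_ge0 ?ler0q //; apply: le_trans le.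
  rewrite le_eqVlt; apply/orP; left; apply/eqP; congr (`|_|).
  apply: eq_bigr => i _; rewrite coef_map /= exprMn mulrA -exprM.
  by rewrite (rmorphM ratr) (rmorphXn ratr).
move: SM; rewrite eqS ler_pM2l ?ltr0n //.
under eq_bigr => i _ do rewrite -ratr_norm -rmorphXn /=.
rewrite -rmorph_sum -rmorphXn /= ler_rat => le.
apply: le_trans le.
have Ln : (L <= n)%N by apply: leqW; rewrite leq_maxr.
under [X in _ <= X]eq_bigr => i _ do rewrite real_normK ?num_real //.
rewrite (big_ord_widen n (fun i => (g`_i * r ^+ i) ^+ 2) Ln) big_mkcond.
by apply: ler_sum => i _; case: ifP => // _; rewrite sqr_ge0.
Qed.

(** * Estimates for powers of a radius below 1 *)

Lemma exprn_bernoulli_le1 (s : rat) (n : nat) : 0 <= s <= 1 ->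
  s ^+ n * (1 + n%:R * (1 - s)) <= 1.
Proof.
move=> /andP[s0 s1]; elim: n => [|n IHn]; first by rewrite expr0 mul0r addr0 mulr1.
apply: le_trans IHn; rewrite exprSr -mulrA; apply: ler_wpM2l; first exact: exprn_ge0.
have : 0 <= (n%:R + 1) * (1 - s) ^+ 2 by rewrite mulr_ge0 ?sqr_ge0 // natr1 ler0n.
rewrite -[n.+1%:R]natr1; lra.
Qed.

Lemma exprn_small (s C : rat) (L : nat) : 0 <= s < 1 -> 0 <= C ->
  exists2 N, (L <= N)%N & s ^+ N * C <= 1.
Proof.
move=> /andP[s0 s1] C0; have t0 : 0 < 1 - s by rewrite subr_gt0.
pose b := Num.bound (C / (1 - s)).
have bP : C / (1 - s) < b%:R by apply: archi_boundP; rewrite divr_ge0 // ltW.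
exists (maxn L b); first exact: leq_maxl.
have s01 : 0 <= s <= 1 by rewrite s0 ltW.
apply: le_trans (exprn_bernoulli_le1 (maxn L b) s01).
apply: ler_wpM2l; first exact: exprn_ge0.
have : C < b%:R * (1 - s) by rewrite -ltr_pdivrMr.
have : b%:R * (1 - s) <= (maxn L b)%:R * (1 - s).
  by rewrite ler_pM2r // ler_nat leq_maxr.
lra.
Qed.

Lemma bernoulli_le (t : rat) (n : nat) : 0 <= t <= 1 -> 1 - n%:R * t <= (1 - t) ^+ n.
Proof.
move=> /andP[t0 t1]; elim: n => [|n IHn]; first by rewrite mul0r subr0 expr0.
rewrite exprS; apply: le_trans (ler_wpM2l _ IHn); last by rewrite subr_ge0.
have n0 : 0 <= n%:R :> rat by rewrite ler0n.
rewrite -natr1; nra.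
Qed.

(** The exponent 4 arises because coefficients on the circle of radius s^2 get squared: the weights
    s^(4i), i < L, must stay above 1/2. *)
Lemma exists_radius (L : nat) :
  exists2 s : rat, 0 <= s < 1 & 2^-1 <= s ^+ (4 * L).
Proof.
pose t : rat := (8 * L.+1%:R)^-1.
have L1 : 1 <= L.+1%:R :> rat by rewrite ler1n.
have t0 : 0 < t by rewrite invr_gt0; lra.
have tL : L.+1%:R * t = 8^-1 by rewrite /t; field; lra.
have t1 : t <= 1 by nra.
exists (1 - t); first by lra.
have t01 : 0 <= t <= 1 by lra.
apply: le_trans (bernoulli_le (4 * L) t01).
by rewrite natrM; move: tL; rewrite -natr1; lra.
Qed.

(** The bound is uniform in [N] because the series of (i+1) s^i sums to 1/(1-s)^2; [sumE] is its
    partial-sum version. *)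
Lemma wnorm_trunc_le (s B : rat) (f : series) (N : nat) : 0 <= s < 1 -> 0 <= B ->
  (forall n, `|f n| <= B * n.+1%:R) ->
  wnorm s (\poly_(i < N) f i) <= B / (1 - s) ^+ 2.
Proof.
move=> /andP[s0 s1] B0 fB; have t0 : 0 < 1 - s by rewrite subr_gt0.
rewrite (wnormE _ (size_poly _ _)) ler_pdivlMr ?exprn_gt0 //.
have sumE : (\sum_(i < N) i.+1%:R * s ^+ i) * (1 - s) ^+ 2
    = 1 - s ^+ N * (1 + N%:R * (1 - s)).
  elim: N => [|N IHN]; first by rewrite big_ord0 expr0; ring.
  rewrite big_ord_recr /= mulrDl IHN [s ^+ N.+1]exprS -[N.+1%:R]natr1; ring.
apply: le_trans (_ : B * (\sum_(i < N) i.+1%:R * s ^+ i) * (1 - s) ^+ 2 <= _).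
  apply: ler_wpM2r; first by rewrite exprn_ge0 // ltW.
  rewrite mulr_sumr; apply: ler_sum => i _; rewrite coef_poly ltn_ord mulrA.
  by apply: ler_wpM2r; rewrite ?exprn_ge0.
rewrite -mulrA sumE -[X in _ <= X]mulr1; apply: ler_wpM2l => //.
have N0 : 0 <= N%:R * (1 - s) by rewrite mulr_ge0 ?ler0n // ltW.
have := exprn_ge0 N s0; nra.
Qed.

(** * Truncated series and the algebraic equation *)

Lemma smul_trunc (u v : {poly rat}) (f g : series) (N : nat) :
  (forall n, (n < N)%N -> u`_n = f n) -> (forall n, (n < N)%N -> v`_n = g n) ->
  forall n, (n < N)%N -> (u * v)`_n = smul f g n.
Proof.
move=> uf vg n nN; rewrite coefM; apply: eq_bigr => i _.
have iN : (i < N)%N by rewrite (leq_ltn_trans _ nN) // -ltnS.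
by rewrite uf // vg // (leq_ltn_trans (leq_subr _ _)).
Qed.

Lemma spow_trunc (u : {poly rat}) (f : series) (N j : nat) :
  (forall n, (n < N)%N -> u`_n = f n) ->
  forall n, (n < N)%N -> (u ^+ j)`_n = spow f j n.
Proof.
move=> uf; elim: j => [|j IHj]; first by move=> n _; rewrite expr0 coef1 /spow /=; case: (n == _).
by move=> n nN; rewrite exprS; apply: smul_trunc nN.
Qed.

(** Replaces the series by a polynomial that can be evaluated at complex points: if [f] is a root of
    [P], the truncation is a root modulo X^N. *)
Lemma eval_bipoly_trunc (P : {poly {poly rat}}) (f : series) (N n : nat) :
  (n < N)%N -> P.[\poly_(i < N) f i]`_n = eval_bipoly P f n.
Proof.
move=> nN; rewrite horner_coef coef_sum; apply: eq_bigr => j _.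
apply: smul_trunc nN => // m mN; apply: spow_trunc mN => l lN.
by rewrite coef_poly lN.
Qed.

(* On the circle |x| = s^2 the truncated equation holds up to s^N times a
   bound independent of N, so lead_coef P * f is bounded there uniformly in s,
   and Parseval bounds its coefficients in mean square. *)
Lemma lead_coef_smul_sq_sum (P : {poly {poly rat}}) (f : series) (B : rat) :
  (1 < size P)%N -> 0 <= B -> (forall n, `|f n| <= B * n.+1%:R) ->
  (forall n, eval_bipoly P f n = 0) ->
  exists M : rat, forall L,
    \sum_(i < L) smul (poly_series (lead_coef P)) f i ^+ 2 <= M.
Proof.
case sP : (size P) => [//|[//|d]] _ B0 fB Pf.
(* Bounds all coefficients of [P] on the closed unit disc; the summand 1 gives [1 <= A], required by
   [lead_root_bound]. *)
pose A := 1 + \sum_(j < d.+2) wnorm 1 P`_j.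
have w0 j : 0 <= wnorm 1 P`_j by apply: wnorm_ge0.
have A1 : 1 <= A by rewrite lerDl sumr_ge0.
have wA (j : nat) : (j <= d.+1)%N -> wnorm 1 P`_j <= A.
  move=> jd; rewrite /A (bigD1 (Ordinal (jd : (j < d.+2)%N))) //=.
  by rewrite addrCA lerDl addr_ge0 ?sumr_ge0.
pose M := d.+2%:R * A ^+ d.+1.
have M0 : 0 <= M by rewrite mulr_ge0 ?ler0n // exprn_ge0 // (le_trans _ A1).
(* The factor 2 undoes the weights, which are at least 1/2. Only now is [s] chosen from [L], and
   then [N] from [s]. *)
exists (2 * M ^+ 2) => L.
have [s s01 sL] := exists_radius L.
have s0 : 0 <= s by case/andP: s01.
have s1 : s <= 1 by case/andP: s01 => _ /ltW.
(* Bounds the norm of [P.[F]] at radius [s] for every truncation order, so [N] may be taken large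
   afterwards. *)
pose C := \sum_(j < d.+2) wnorm s P`_j * (B / (1 - s) ^+ 2) ^+ j.
have C0 : 0 <= C.
  apply: sumr_ge0 => j _; rewrite mulr_ge0 ?wnorm_ge0 ?exprn_ge0 //.
  by rewrite divr_ge0 // sqr_ge0.
have [N LN NC] := exprn_small L s01 C0.
pose F := \poly_(i < N) f i; pose g := lead_coef P * F; pose E := P.[F].
have E0 n : (n < N)%N -> E`_n = 0 by move=> nN; rewrite /E eval_bipoly_trunc.
have Es : wnorm s E <= C.
  rewrite /E horner_coef sP; apply: le_trans (wnorm_sum _ (fun j => P`_j * F ^+ j) s0) _.
  apply: ler_sum => j _; apply: le_trans (wnormM _ _ s0) _.
  apply: ler_wpM2l; first exact: wnorm_ge0.
  apply: le_trans (wnormX _ _ s0) _; rewrite lerXn2r ?nnegrE ?wnorm_ge0 //.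
    by rewrite divr_ge0 // sqr_ge0.
  exact: wnorm_trunc_le.
have Es2 : wnorm (s ^+ 2) E <= 1.
  apply: le_trans (_ : s ^+ N * wnorm s E <= _).
    by apply: wnorm_vanishing; rewrite // s0.
  by apply: le_trans NC; apply: ler_wpM2l => //; apply: exprn_ge0.
have gM (x : algC) : `|x| = ratr (s ^+ 2) -> `|(map_poly ratr g).[x]| <= ratr M.
  move=> xs; have x1 : `|x| <= ratr 1 by rewrite xs ler_rat exprn_ile1.
  have r1 : 1 = ratr 1 :> algC by rewrite rmorph1.
  rewrite rmorphM hornerM /= lead_coefE sP /=.
  have := @lead_root_bound d (fun j => (map_poly ratr P`_j).[x]) (map_poly ratr F).[x] (ratr A).
  rewrite /M (rmorphM ratr) (rmorphXn ratr) /= ratr_nat; apply.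
  - by rewrite r1 ler_rat.
  - move=> j jd; apply: le_trans (norm_horner_le_wnorm _ _ x1) _ => //.
    by rewrite ler_rat wA.
  apply: le_trans (_ : ratr (wnorm (s ^+ 2) E) <= _); last by rewrite r1 ler_rat.
  have := @norm_horner_le_wnorm (s ^+ 2) E x (sqr_ge0 _); rewrite xs => /(_ (lexx _)).
  suff -> : (map_poly ratr E).[x]
      = \sum_(j < d.+2) (map_poly ratr P`_j).[x] * (map_poly ratr F).[x] ^+ j by [].
  rewrite /E [P.[F]]horner_coef sP rmorph_sum horner_sum; apply: eq_bigr => j _.
  by rewrite /= rmorphM rmorphXn /= hornerM horner_exp.
have le := poly_sq_sum_le L (sqr_ge0 s) M0 gM.
suff : 2^-1 * \sum_(i < L) smul (poly_series (lead_coef P)) f i ^+ 2 <= M ^+ 2 by lra.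
apply: le_trans le; rewrite mulr_sumr; apply: ler_sum => i _.
have <- : g`_i = smul (poly_series (lead_coef P)) f i.
  have iN : (i < N)%N by rewrite (leq_trans _ LN).
  by apply: smul_trunc iN => // n nN; rewrite coef_poly nN.
rewrite exprMn mulrC; apply: ler_wpM2l; first exact: sqr_ge0.
rewrite -!exprM; apply: le_trans sL _.
by rewrite ler_wiXn2l // [(i * 2)%N]mulnC mulnA leq_mul // ltnW.
Qed.

(** Each non-zero integer contributes at least 1, so infinitely many would make the partial sums
    unbounded. *)
Lemma int_sq_sum_eventually0 (g : nat -> rat) (M : rat) :
  (forall n, g n \is a Num.int) -> (forall L, \sum_(i < L) g i ^+ 2 <= M) ->
  exists N, forall n, (N <= n)%N -> g n = 0.
Proof.
move=> gZ gM; apply: NNPP => noN.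
suff ubd K : exists L, K%:R <= \sum_(i < L) g i ^+ 2.
  have M0 : 0 <= M by rewrite (le_trans _ (gM 0)) // big_ord0.
  have [L] := ubd (Num.bound M); have := archi_boundP M0; have := gM L; lra.
elim: K => [|K [L KL]]; first by exists 0; rewrite big_ord0.
have [n Ln gn] : exists2 n, (L <= n)%N & g n != 0.
  apply: NNPP => h; apply: noN; exists L => n Ln; apply/eqP.
  by case: eqP => // /eqP gn; case: h; exists n.
exists n.+1; rewrite big_ord_recr /= -natr1; apply: lerD.
  apply: le_trans KL _; rewrite (big_ord_widen n (fun i => g i ^+ 2) Ln) big_mkcond.
  by apply: ler_sum => i _; case: ifP; rewrite ?sqr_ge0.
exact: sqr_intr_ge1.
Qed.

(** The recurrence is the leading coefficient of [P]: its product with [f] is square-summable, and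
    integral once the denominators of [lead_coef P] are cleared. *)
Lemma algebraic_lin_rec (f : series) (B : rat) :
  (forall n, f n \is a Num.int) -> (forall n, `|f n| <= B * n.+1%:R) ->
  algebraic_QX f ->
  exists2 p : {poly rat}, p != 0 &
    exists N, forall n, (N <= n)%N -> smul (poly_series p) f n = 0.
Proof.
move=> fZ fB [P [P0 Pf]].
have B0 : 0 <= B by have := le_trans (normr_ge0 _) (fB 0%N); rewrite mulr1.
(* If [P] is constant in the unknown, the equation says that its only coefficient is zero. *)
case: (ltnP 1 (size P)) => [P1|/size1_polyC P1]; last first.
  case/eqP: P0; rewrite P1; congr (_%:P); apply/polyP => n; rewrite coef0.
  have [p0|p0] := eqVneq P`_0 0; first by rewrite p0 coef0.
  have := Pf n; rewrite /eval_bipoly P1 size_polyC p0 big_ord1 coefC /= /smul.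
  rewrite big_ord_recr /= subnn eqxx mulr1 big1 ?add0r // => i _.
  by rewrite subn_eq0 leqNgt ltn_ord mulr0.
have [M sqM] := lead_coef_smul_sq_sum P1 B0 fB Pf.
exists (lead_coef P); first by rewrite lead_coef_eq0.
have [q [a a0 pq]] := rat_poly_scale (lead_coef P).
have a0' : a%:~R != 0 :> rat by rewrite intr_eq0.
have [|L|N gN] := @int_sq_sum_eventually0
    (fun n => a%:~R * smul (poly_series (lead_coef P)) f n) (a%:~R ^+ 2 * M).
- move=> n; rewrite /smul mulr_sumr; apply: rpred_sum => i _.
  rewrite /poly_series pq coefZ coef_map /= !mulrA divff // mul1r.
  by apply: rpredM; rewrite ?intr_int.
- under eq_bigr do rewrite exprMn; rewrite -mulr_sumr.
  by apply: ler_wpM2l; rewrite ?sqr_ge0.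
by exists N => n /gN/eqP; rewrite mulf_eq0 (negbTE a0') => /eqP.
Qed.

(** * Linear recurrences and periodicity *)
Lemma smul_poly_large (p : {poly rat}) (f : series) (n : nat) : (size p <= n.+1)%N ->
  smul (poly_series p) f n = \sum_(i < size p) p`_i * f (n - i)%N.
Proof.
move=> pn; rewrite (big_ord_widen _ (fun i => p`_i * f (n - i)%N) pn) big_mkcond.
by apply: eq_bigr => i _; case: ltnP => // pi; rewrite /poly_series nth_default ?mul0r.
Qed.

Lemma smul_polyB (p q : {poly rat}) (f : series) (n : nat) :
  smul (poly_series (p - q)) f n
  = smul (poly_series p) f n - smul (poly_series q) f n.
Proof.
by rewrite -sumrB; apply: eq_bigr => i _; rewrite /poly_series coefB mulrBl.
Qed.

Lemma smul_polyMX (p : {poly rat}) (f : series) (n : nat) :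
  smul (poly_series (p * 'X)) f n.+1 = smul (poly_series p) f n.
Proof.
rewrite /smul big_ord_recl /poly_series coefMX mul0r add0r.
by apply: eq_bigr => i _; rewrite coefMX.
Qed.

Lemma smul_polyXn (m : nat) (f : series) (n : nat) :
  smul (poly_series 'X^m) f (n + m)%N = f n.
Proof.
have mn : (m < (n + m).+1)%N by rewrite ltnS leq_addl.
rewrite /smul (bigD1 (Ordinal mn)) //= /poly_series coefXn eqxx mul1r addnK.
rewrite big1 ?addr0 // => i; rewrite coefXn -val_eqE /= => /negbTE->.
by rewrite mul0r.
Qed.

(** The product p f is a polynomial; with [q] its negative, [f] is a root of q + p Y. *)
Lemma lin_rec_algebraic (f : series) (p : {poly rat}) (N : nat) : p != 0 ->
  (forall n, (N <= n)%N -> smul (poly_series p) f n = 0) -> algebraic_QX f.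
Proof.
move=> p0 pf; pose q := - \poly_(n < N) smul (poly_series p) f n.
have PE : Poly [:: q; p] = [:: q; p] :> seq _ by rewrite (@PolyK _ 0).
exists (Poly [:: q; p]); split.
  by rewrite -size_poly_gt0 PE.
have f1 n : spow f 1 n = f n.
  rewrite /spow /= /smul big_ord_recr /= subnn eqxx mulr1 big1 ?add0r // => i _.
  by rewrite subn_eq0 leqNgt ltn_ord mulr0.
move=> n.
transitivity (smul (poly_series q) (spow f 0) n + smul (poly_series p) (spow f 1) n).
  by rewrite /eval_bipoly PE !big_ord_recl big_ord0 addr0.
have -> : smul (poly_series p) (spow f 1) n = smul (poly_series p) f n.
  by apply: eq_bigr => i _; rewrite f1.
have -> : smul (poly_series q) (spow f 0) n = q`_n.
  rewrite /smul big_ord_recr /= subnn mulr1 big1 ?add0r // => i _.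
  by rewrite subn_eq0 leqNgt ltn_ord mulr0.
rewrite /q coefN coef_poly.
by case: ltnP => [_|/pf pn]; rewrite ?addNr // pn oppr0 addr0.
Qed.

Lemma pigeonhole_nat (T : finType) (F : nat -> T) (N : nat) :
  exists x y, [/\ (N <= x)%N, (x < y)%N & F x = F y].
Proof.
have : ~~ injectiveb (fun i : 'I_#|T|.+1 => F (N + i)%N).
  by apply/negP => /injectiveP/leq_card; rewrite card_ord ltnn.
move=> /injectivePn[i [j ij eqF]].
case: (ltngtP i j) => [lt|lt|/val_inj/eqP]; last by rewrite (negbTE ij).
  by exists (N + i)%N, (N + j)%N; rewrite leq_addr ltn_add2l.
by exists (N + j)%N, (N + i)%N; rewrite leq_addr ltn_add2l.
Qed.

(** Bounded values leave finitely many windows of [e] consecutive terms; two of them coincide, and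
    the recurrence propagates the coincidence. *)
Lemma lin_rec_eventually_periodic (h : nat -> nat) (K : nat) (p : {poly rat}) (N : nat) :
  (forall n, (h n <= K)%N) -> p != 0 ->
  (forall n, (N <= n)%N -> smul (poly_series p) (fun n => (h n)%:R) n = 0) ->
  eventually_periodic h.
Proof.
move=> hK p0 ph; pose s := size p.
have s0 : (0 < s)%N by rewrite size_poly_gt0.
have exv : exists v, p`_v != 0 by exists s.-1; rewrite -lead_coefE lead_coef_eq0.
(* [p] may be divisible by X^v; the order of the recurrence is therefore [e], the degree of [p]
   minus [v]. *)
pose v := ex_minn exv.
have [pv vmin] : p`_v != 0 /\ forall i, (i < v)%N -> p`_i = 0.
  rewrite /v; case: ex_minnP => u pu umin; split=> // i iu; apply/eqP.
  by case: eqP => // /eqP/umin; rewrite leqNgt iu.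
have vs : (v < s)%N by rewrite ltnNge; apply: contra pv => sv; rewrite nth_default.
pose e := (s.-1 - v)%N.
(* The lowest coefficient of p determines each term from the e preceding ones. *)
have next x y : (N <= x)%N -> (N <= y)%N ->
    (forall j, (j < e)%N -> h (x + j)%N = h (y + j)%N) -> h (x + e)%N = h (y + e)%N.
  move=> Nx Ny hxy.
  (* At this index the term i = v involves h (x + e), and the terms i > v only earlier values inside
     the window. *)
  have := ph (x + s.-1)%N (leq_trans Nx (leq_addr _ _)).
  rewrite -(ph (y + s.-1)%N (leq_trans Ny (leq_addr _ _))).
  rewrite !smul_poly_large -/s; try lia.
  rewrite (bigD1 (Ordinal vs)) //= [in RHS](bigD1 (Ordinal vs)) //=.
  rewrite [X in _ + X = _](eq_bigr (fun i : 'I_s => p`_i * (h (y + s.-1 - i)%N)%:R)).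
    move=> /addIr /(mulfI pv) /eqP; rewrite eqr_nat => /eqP.
    by rewrite /e -!addnBA //; lia.
  move=> i; rewrite -val_eqE /= => iv; case: (ltngtP i v) iv => // iv _.
    by rewrite vmin // !mul0r.
  congr (_ * _%:R); have is_ := ltn_ord i; rewrite -!addnBA; try lia.
  by apply: hxy; rewrite /e; lia.
pose F x : {ffun 'I_e -> 'I_K.+1} := [ffun j : 'I_e => inord (h (x + j)%N)].
have [x [y [Nx xy Fxy]]] := pigeonhole_nat F N.
have base j : (j < e)%N -> h (x + j)%N = h (y + j)%N.
  move=> je; have /ffunP/(_ (Ordinal je)) := Fxy; rewrite !ffunE /=.
  by move/(congr1 (@nat_of_ord _)); rewrite !inordK ?ltnS.
have all n : h (x + n)%N = h (y + n)%N.
  elim/ltn_ind: n => n IHn; case: (ltnP n e) => [/base//|en].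
  rewrite -(subnK en) !addnA; apply: next; try lia.
  by move=> j je; rewrite -!addnA; apply: IHn; lia.
exists x, (y - x)%N; split; first by rewrite subn_gt0.
move=> n xn; have := all (n - x)%N.
by rewrite subnKC // => ->; congr h; lia.
Qed.

(** Past the degree of [p], multiplication by [p] commutes with the shift, so a recurrence for [f]
    passes to its differences. *)
Lemma smul_polyS (p : {poly rat}) (f : series) (n : nat) : (size p <= n.+1)%N ->
  smul (poly_series p) (fun n => f n.+1 - f n) n
  = smul (poly_series p) f n.+1 - smul (poly_series p) f n.
Proof.
move=> pn; rewrite !smul_poly_large // -?sumrB; last exact: leqW.
apply: eq_bigr => i _; rewrite mulrBr subSn //.
by have := ltn_ord i; lia.
Qed.

Lemma periodic_algebraic (f : series) :
  eventually_periodic f -> algebraic_QX f.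
Proof.
(* The constant 1 is written ['X^0] so that [smul_polyXn] handles both terms. *)
move=> [N [d [d1 fd]]]; apply: (@lin_rec_algebraic f ('X^d - 'X^0) (N + d)).
  by rewrite -size_poly_gt0 expr0 size_XnsubC.
move=> n Nn; rewrite smul_polyB.
rewrite -{1}(@subnK d n); last by lia.
rewrite smul_polyXn -{2}(addn0 n) smul_polyXn -fd; last by lia.
by rewrite subnK ?subrr //; lia.
Qed.

(** Multiplying by X^m - 1 leaves a series with eventually constant coefficients, which X - 1
    annihilates from some index on. *)
Lemma quasi_periodic_algebraic (f : series) (N m : nat) (c : rat) : (0 < m)%N ->
  (forall n, (N <= n)%N -> f (n + m)%N = f n + c) -> algebraic_QX f.
Proof.
move=> m0 fm; pose u : {poly rat} := 'X^m - 'X^0.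
have uE n : (N + m <= n)%N -> smul (poly_series u) f n = - c.
  move=> Nn; rewrite smul_polyB -{1}(@subnK m n); last by lia.
  rewrite smul_polyXn -{2}(addn0 n) smul_polyXn -{2}(@subnK m n); last by lia.
  by rewrite fm; [ring|lia].
apply: (@lin_rec_algebraic f (u * ('X - 1)) (N + m).+1).
  rewrite mulf_neq0 // -size_poly_gt0 ?expr0 ?size_XnsubC //.
  by rewrite size_XsubC.
case=> [//|n] Nn; rewrite mulrBr mulr1 smul_polyB smul_polyMX !uE ?subrr //.
by lia.
Qed.

(** * Occurrences of letters in a fixed point *)

Section Words.

Variables (k : nat) (sigma : 'I_k -> seq 'I_k) (w : nat -> 'I_k).

(** Applies [sigma] first and the iterate afterwards, matching the left multiplication in
    [mxpow]. *)
Fixpoint subst_iter (n : nat) (a : 'I_k) : seq 'I_k :=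
  if n is m.+1 then flatten (map (subst_iter m) (sigma a)) else [:: a].

Lemma mxpow_ge0 (n : nat) (i j : 'I_k) : 0 <= mxpow (subst_matrix sigma) n i j.
Proof.
elim: n i j => [|n IHn] i j; first by rewrite /mxpow /= mxE ler0n.
by rewrite /mxpow /= mxE sumr_ge0 // => l _; rewrite mulr_ge0 // mxE.
Qed.

(** A positive entry yields a path of length [n] from [i] to [j] in which each letter occurs in the
    image of the preceding one. *)
Lemma mem_subst_iter (n : nat) (i j : 'I_k) :
  0 < mxpow (subst_matrix sigma) n i j -> j \in subst_iter n i.
Proof.
elim: n i => [|n IHn] i; first by rewrite /mxpow /= mxE inE eq_sym; case: eqP.
rewrite /mxpow /= mxE => s0.
have [l] : exists l, subst_matrix sigma i l * mxpow (subst_matrix sigma) n l j != 0.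
  apply/existsP; apply: contraLR s0 => /existsPn h; rewrite big1 ?ltxx // => l _.
  by apply/eqP; have := h l; rewrite negbK.
rewrite mulf_eq0 negb_or mxE => /andP[li lj].
apply/flattenP; exists (subst_iter n l).
  apply: map_f; rewrite -has_pred1 has_count lt0n; by apply: contraNneq li => ->.
by apply: IHn; rewrite lt_neqAle eq_sym lj mxpow_ge0.
Qed.

Lemma flatten_subst_iter (n : nat) (u : seq 'I_k) :
  flatten (map (subst_iter n.+1) u)
  = flatten (map (subst_iter n) (flatten (map sigma u))).
Proof. by elim: u => //= a u ->; rewrite map_cat flatten_cat. Qed.

Lemma fixed_point_iter (n : nat) : fixed_point sigma w -> fixed_point (subst_iter n) w.
Proof.
move=> fixw; elim: n => [|n IHn] m /=.
  by rewrite flatten_seq1 size_mkseq.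
have := flatten_subst_iter n (pref w m); rewrite /= => ->.
by rewrite (fixw m); apply: IHn.
Qed.

(** For a suitable power tau of [sigma], every tau(b) contains [a], and [w] is a concatenation of
    such blocks, of bounded length. *)
Lemma mem_window (a : 'I_k) : primitive sigma -> fixed_point sigma w ->
  exists L, forall x, exists y, [/\ (x <= y)%N, (y < x + L)%N & w y = a].
Proof.
move=> [n [n0 prim]] fixw; pose tau := subst_iter n.
have taua b : a \in tau b by apply: mem_subst_iter.
pose L := \max_(b < k) size (tau b).
have tauL b : (size (tau b) <= L)%N by apply: leq_bigmax.
have tau0 b : (0 < size (tau b))%N by case: (tau b) (taua b).
pose S m := size (flatten (map tau (pref w m))).
have prefS m : pref w m.+1 = pref w m ++ [:: w m].
  by rewrite /pref /mkseq -addn1 iotaD map_cat.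
have SS m : S m.+1 = (S m + size (tau (w m)))%N.
  by rewrite /S prefS map_cat flatten_cat size_cat /= cats0.
have block m : exists y, [/\ (S m <= y)%N, (y < S m.+1)%N & w y = a].
  pose i := index a (tau (w m)).
  have ilt : (i < size (tau (w m)))%N by rewrite index_mem.
  exists (S m + i)%N; split; [lia | rewrite SS; lia |].
  have lt : (S m + i < S m.+1)%N by rewrite SS; lia.
  rewrite -(nth_mkseq a w lt) -/(pref w _).
  rewrite -(fixed_point_iter n fixw m.+1) -/tau prefS map_cat flatten_cat nth_cat /=.
  by rewrite -/(S m) ltnNge leq_addr /= addKn cats0 nth_index.
have near x : exists m, (x <= S m)%N /\ (S m < x + L.+1)%N.
  elim: x => [|x [m [xm mx]]]; first by exists 0%N.
  case: (ltngtP x (S m)) xm => // [lt|eq] _; first by exists m; lia.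
  exists m.+1; rewrite SS; have := tauL (w m); have := tau0 (w m); lia.
(* A block starts at most [L] places after [x], and [a] occurs within its at most [L] letters. *)
exists (L.+1 + L)%N => x; have [m [xm mx]] := near x; have [y [my ym wy]] := block m.
by exists y; rewrite SS in ym; split=> //; [lia | have := tauL (w m); lia].
Qed.

(** The other letters get a common threshold (a maximum) and period (a product); [i] sits exactly
    where all their indicators vanish. *)
Lemma eventually_periodic_letters (i : 'I_k) :
  (forall j, j != i -> eventually_periodic (fun n => w n == j)) ->
  eventually_periodic w.
Proof.
move=> per.
have [N [d [d1 eqw]]] : exists N d, (1 <= d)%N /\ forall j, j \in rem i (enum 'I_k) ->
    forall n, (N <= n)%N -> (w (n + d)%N == j) = (w n == j).
  have : forall j, j \in rem i (enum 'I_k) -> eventually_periodic (fun n => w n == j).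
    by move=> j; rewrite (mem_rem_uniq _ (enum_uniq _)) inE => /andP[/per].
  elim: (rem _ _) => [|j s IHs] pers; first by exists 0%N, 1%N.
  have [l ls|N [d [d1 eqs]]] := IHs; first by apply: pers; rewrite inE ls orbT.
  have [|N' [d' [d1' eqj]]] := pers j; first by rewrite inE eqxx.
  have mul (f : nat -> bool) M c : (forall n, (M <= n)%N -> f (n + c)%N = f n) ->
      forall e n, (M <= n)%N -> f (n + e * c)%N = f n.
    move=> fc; elim=> [|e IHe] n Mn; first by rewrite mul0n addn0.
    by rewrite mulSn addnCA addnC fc ?IHe // (leq_trans Mn) ?leq_addr.
  exists (maxn N N'), (d' * d)%N; split; first by rewrite muln_gt0 d1 d1'.
  move=> l; rewrite inE => /predU1P[->|ls] n; rewrite geq_max => /andP[Nn Nn'].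
    by rewrite mulnC (mul (fun n => w n == j) N').
  by rewrite (mul (fun n => w n == l) N) //; apply: eqs.
have mem_s j : j != i -> j \in rem i (enum 'I_k).
  by move=> ji; rewrite (mem_rem_uniq _ (enum_uniq _)) inE ji mem_enum.
exists N, d; split=> // n Nn.
have [wi|wi] := eqVneq (w n) i; last by apply/eqP; rewrite eqw ?mem_s ?eqxx.
have [->//|wi'] := eqVneq (w (n + d)%N) i.
by have := eqw _ (mem_s _ wi') n Nn; rewrite eqxx => /esym/eqP.
Qed.

(** * Counting function and positions of one letter *)

Variable a : 'I_k.
Hypothesis window : exists L, forall x, exists y, [/\ (x <= y)%N, (y < x + L)%N & w y = a].

(** Position [n] itself is excluded, so an occurrence at [x] has rank [(occ x).+1]. *)
Definition occ (n : nat) : nat := count_mem a (pref w n).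

Lemma occS (n : nat) : occ n.+1 = (occ n + (w n == a))%N.
Proof. by rewrite /occ /pref /mkseq -addn1 iotaD map_cat count_cat /= addn0. Qed.

Lemma leq_occ (m n : nat) : (m <= n)%N -> (occ m <= occ n)%N.
Proof.
move=> /subnK<-; elim: (n - m)%N => // l IHl.
by rewrite addSn occS (leq_trans IHl) ?leq_addr.
Qed.

Lemma occ_ltn (x y : nat) : w x = a -> (x < y)%N -> (occ x < occ y)%N.
Proof. by move=> wx /leq_occ; rewrite occS wx eqxx addn1. Qed.

(** [epsilon] needs a witness: the windows make [occ] unbounded, and the least index where it
    exceeds [n] is one past the wanted occurrence. *)
Lemma occ_posP (n : nat) : w (occ_pos w a n.+1) = a /\ occ (occ_pos w a n.+1) = n.
Proof.
pose Q m := w m = a /\ occ m = n.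
suff exQ : exists m, Q m by exact: (epsilon_spec (inhabits 0%N) Q exQ).
case: window => L win.
have exm : exists m, (n < occ m)%N.
  elim: n {Q} => [|n [m nm]].
    have [y [_ _ wy]] := win 0%N; exists y.+1; rewrite occS wy eqxx; lia.
  have [y [my _ wy]] := win m; exists y.+1; rewrite occS wy eqxx.
  have := leq_occ my; lia.
case: (ex_minnP exm) => [[//|m]] nm mmin.
have mn : (occ m <= n)%N by rewrite leqNgt; apply/negP => /mmin; rewrite ltnn.
exists m; move: nm; rewrite occS; case: eqP => /= [wm|_] nm; last by lia.
by split=> //; lia.
Qed.

Lemma occ_pos_occ (x : nat) : w x = a -> occ_pos w a (occ x).+1 = x.
Proof.
move=> wx; have [wp op] := occ_posP (occ x).
case: (ltngtP (occ_pos w a (occ x).+1) x) => // lt.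
  by have := occ_ltn wp lt; rewrite op ltnn.
by have := occ_ltn wx lt; rewrite op ltnn.
Qed.

Lemma ltn_occ_pos (m n : nat) : (m < n)%N -> (occ_pos w a m.+1 < occ_pos w a n.+1)%N.
Proof.
move=> mn; rewrite ltnNge; apply/negP => /leq_occ.
by rewrite (occ_posP m).2 (occ_posP n).2 leqNgt mn.
Qed.

(** At index 0 [occ_pos] would give the first occurrence, since [0.-1] is 0; the series has constant
    coefficient 0 instead. *)
Definition occ_pos0 (n : nat) : nat := if n is 0 then 0%N else occ_pos w a n.

Lemma pos_seriesE (n : nat) : pos_series w a n = (occ_pos0 n)%:R.
Proof. by case: n. Qed.

(** The window just after an occurrence contains another one, and none lies strictly between
    consecutive positions. *)
Lemma occ_pos_gap : exists K, forall n,
  (occ_pos0 n <= occ_pos0 n.+1 <= occ_pos0 n + K)%N.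
Proof.
case: window => L win; exists L => -[|n] /=.
  have [y [_ yL wy]] := win 0%N.
  have [wp op] := occ_posP 0.
  rewrite leqNgt; apply/negP => lt.
  have := occ_ltn wy (_ : y < occ_pos w a 1)%N; rewrite op; lia.
rewrite (ltnW (ltn_occ_pos _)) //=.
have [wp op] := occ_posP n; have [wp' op'] := occ_posP n.+1.
have [y [py yL wy]] := win (occ_pos w a n.+1).+1.
have oy : (n < occ y)%N by rewrite -{1}op occ_ltn.
rewrite leqNgt; apply/negP => lt.
have := occ_ltn wy (_ : y < occ_pos w a n.+2)%N; rewrite op'; lia.
Qed.

Lemma eventually_periodic_occ_pos :
  eventually_periodic (fun n => w n == a) ->
  exists N m d, (0 < m)%N /\
    forall n, (N <= n)%N -> occ_pos0 (n + m) = (occ_pos0 n + d)%N.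
Proof.
(* [m] counts the occurrences in one period: moving by [d] raises the rank by [m]. *)
move=> [N [d [d1 wd]]]; pose m := (occ (N + d) - occ N)%N.
have occd x : (N <= x)%N -> occ (x + d) = (occ x + m)%N.
  move=> /subnK<-; elim: (x - N)%N => [|l IHl].
    by rewrite add0n /m subnKC // leq_occ ?leq_addr.
  by rewrite !addSn !occS IHl wd ?leq_addl // addnAC.
have shift n : (N < n)%N -> occ_pos0 (n + m) = (occ_pos0 n + d)%N.
  case: n => // n; rewrite ltnS => Nn; rewrite addSn /=.
  have [wp op] := occ_posP n.
  have Np : (N <= occ_pos w a n.+1)%N.
    apply: (leq_trans Nn); rewrite -{1}op.
    by apply: leq_trans (count_size _ _) _; rewrite size_mkseq.
  have wpd : w (occ_pos w a n.+1 + d)%N = a by apply/eqP; rewrite wd // wp.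
  by have := occ_pos_occ wpd; rewrite occd // op.
exists N.+1, m, d; split; last by move=> n; apply: shift.
(* With m = 0 a position would equal itself plus d >= 1. *)
by rewrite lt0n; apply/eqP => m0; have := shift N.+1 (ltnSn _); rewrite m0 addn0; lia.
Qed.

Lemma occ_pos_eventually_periodic :
  eventually_periodic (fun n => (occ_pos0 n.+1 - occ_pos0 n)%N) ->
  eventually_periodic (fun n => w n == a).
Proof.
move=> [N [m [m1 per]]]; have [K gap] := occ_pos_gap.
(* [d] is the sum of the gaps over one period. Starting at [N.+1] avoids the artificial value at 0,
   where strict growth can fail. *)
pose p n := occ_pos0 n; pose d := (p (N.+1 + m)%N - p N.+1)%N.
have mono i j : (0 < i)%N -> (i < j)%N -> (p i < p j)%N.
  by case: i j => // i [//|j] _ ij; apply: ltn_occ_pos.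
have shift n : p (n + N.+1 + m)%N = (p (n + N.+1) + d)%N.
  elim: n => [|n IHn]; first by have := mono N.+1 (N.+1 + m)%N; rewrite /d add0n; lia.
  have := per (n + N.+1)%N; have := gap (n + N.+1)%N; have := gap (n + N.+1 + m)%N.
  rewrite !addSn -!/(p _) in IHn *; lia.
exists (p N.+1), d; split; first by rewrite subn_gt0 mono //; lia.
have posE x : (p N.+1 <= x)%N -> (w x == a) -> exists n, x = p (n + N.+1)%N.
  move=> Nx /eqP wx; exists (occ x - N)%N.
  have : (N <= occ x)%N by have := leq_occ Nx; rewrite (occ_posP N).2.
  by move=> No; rewrite addnS subnK //; have := occ_pos_occ wx.
have wpos n : w (p n.+1) == a by apply/eqP; case: (occ_posP n).
move=> x Nx; apply/idP/idP => [wxd|/(posE _ Nx)[n ->]]; last first.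
  by rewrite -shift !addnS wpos.
have [n xd] := posE _ (leq_trans Nx (leq_addr _ _)) wxd.
(* The occurrence at x + d has rank at least N + 1 + m, so going back [m] ranks lands on [x]. *)
have mn : (m <= n)%N.
  rewrite leqNgt; apply/negP => nm.
  have := mono (n + N.+1)%N (N.+1 + m)%N; rewrite -xd; have := shift 0%N.
  rewrite !add0n; lia.
have := shift (n - m)%N; rewrite (_ : (n - m + N.+1 + m)%N = (n + N.+1)%N); last by lia.
by rewrite -xd => /addIn ->; rewrite addnS wpos.
Qed.

End Words.

(** * Algebraicity criteria and the equivalences *)

Lemma char_series_algebraicP (k : nat) (w : nat -> 'I_k) (a : 'I_k) :
  algebraic_QX (char_series w a) <-> eventually_periodic (fun n => w n == a).
Proof.
split=> [alg|[N [d [d1 per]]]]; last first.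
  by apply: periodic_algebraic; exists N, d; split=> // n Nn; rewrite /char_series per.
have cE n : char_series w a n = (w n == a : nat)%:R by rewrite /char_series; case: eqP.
have [||p p0 [N pN]] := @algebraic_lin_rec (char_series w a) 1 _ _ alg.
- by move=> n; rewrite cE; apply: natr_int.
- move=> n; rewrite cE mul1r ger0_norm ?ler0n // ler_nat.
  by apply: leq_trans (leq_b1 _) _.
have [|n Nn|M [d [d1 per]]] :=
    @lin_rec_eventually_periodic (fun n => w n == a : nat) 1 p N _ p0.
- by move=> n; apply: leq_b1.
- by rewrite -[RHS](pN n Nn); apply: eq_bigr => i _; rewrite cE.
by exists M, d; split=> // n /per; case: (_ == _); case: (_ == _).
Qed.

Lemma pos_series_algebraicP (k : nat) (w : nat -> 'I_k) (a : 'I_k) :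
  (exists L, forall x, exists y, [/\ (x <= y)%N, (y < x + L)%N & w y = a]) ->
  algebraic_QX (pos_series w a) <-> eventually_periodic (fun n => w n == a).
Proof.
move=> win; split=> [alg|per]; last first.
  have [N [m [d [m0 shift]]]] := eventually_periodic_occ_pos win per.
  apply: (@quasi_periodic_algebraic _ N m d%:R m0) => n Nn.
  by rewrite !pos_seriesE shift // natrD.
have [K gap] := occ_pos_gap win.
have bound n : (occ_pos0 w a n <= K * n)%N.
  by elim: n => [|n IHn] //; have := gap n; rewrite mulnS; lia.
have [||p p0 [N pN]] := @algebraic_lin_rec (pos_series w a) K%:R _ _ alg.
- by move=> n; rewrite pos_seriesE; apply: natr_int.
- move=> n; rewrite pos_seriesE ger0_norm ?ler0n // -natrM ler_nat.
  by apply: leq_trans (bound n) _; rewrite leq_mul2l leqnSn orbT.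
apply: (occ_pos_eventually_periodic win).
(* Positions are unbounded, but their differences are at most [K]; beyond [size p] the recurrence
   holds for them by [smul_polyS]. *)
apply: (@lin_rec_eventually_periodic _ K p (maxn N (size p)) _ p0).
  by move=> n; have := gap n; lia.
move=> n; rewrite geq_max => /andP[Nn pn].
transitivity (smul (poly_series p) (fun n => pos_series w a n.+1 - pos_series w a n) n).
  apply: eq_bigr => i _; rewrite !pos_seriesE natrB //.
  by case/andP: (gap (n - i)%N).
by rewrite smul_polyS ?pN ?subrr ?leqW.
Qed.

Theorem theorem4p2 (k : nat) (hk : (2 <= k)%N)
  (sigma : 'I_k -> seq 'I_k) (hne : forall a : 'I_k, sigma a <> [::])
  (hprim : primitive sigma)
  (w : nat -> 'I_k) (hfix : fixed_point sigma w) :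
  [<-> ~ eventually_periodic w;
       exists i : 'I_k, transcendental_QX (char_series w i);
       exists i j : 'I_k, (i < j)%N /\ transcendental_QX (char_series w i)
                             /\ transcendental_QX (char_series w j);
       exists i : 'I_k, transcendental_QX (pos_series w i);
       exists i j : 'I_k, (i < j)%N /\ transcendental_QX (pos_series w i)
                             /\ transcendental_QX (pos_series w j)].
Proof.
have win a := mem_window a hprim hfix.
pose per a := eventually_periodic (fun n => w n == a).
have charP a : transcendental_QX (char_series w a) <-> ~ per a.
  by split=> h1 h2; apply: h1; apply/char_series_algebraicP.
have posP a : transcendental_QX (pos_series w a) <-> ~ per a.
  by split=> h1 h2; apply: h1; apply/(pos_series_algebraicP (win a)).
have not_per a : ~ per a -> ~ eventually_periodic w.
  by move=> na [N [d [d1 wd]]]; apply: na; exists N, d; split=> // n /wd->.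
have other a : ~ eventually_periodic w -> exists2 b, b != a & ~ per b.
  move=> nw; apply: NNPP => nb; apply: nw; apply: (eventually_periodic_letters (i := a)).
  by move=> b ba; apply: NNPP => pb; apply: nb; exists b.
have two : ~ eventually_periodic w -> exists i j : 'I_k, (i < j)%N /\ ~ per i /\ ~ per j.
  (* Excluding an arbitrary letter, here [w 0], gives a first non-periodic letter; excluding that
     one gives a second. *)
  move=> nw; have [a _ pa] := other (w 0%N) nw; have [b ba pb] := other a nw.
  case: (ltngtP a b) => [ab|ab|/val_inj ab]; first by exists a, b.
    by exists b, a.
  by rewrite ab eqxx in ba.
tfae.
- by move=> /two[i [j [_ [pi _]]]]; exists i; apply/charP.
- move=> [i /charP/not_per/two[a [b [ab [pa pb]]]]].
  by exists a, b; split=> //; split; apply/charP.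
- by move=> [i [j [_ [/charP pi _]]]]; exists i; apply/posP.
- move=> [i /posP/not_per/two[a [b [ab [pa pb]]]]].
  by exists a, b; split=> //; split; apply/posP.
- by move=> [i [j [_ [/posP/not_per]]]].
Qed.
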